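(* Let $m \ge 1$ be odd and $n \ge 4$ be even. The honeycomb toroidal graph $\mathrm{HTG}(m,n,1)$ is 2-spanning cyclable if and only if $m \geq 3$ and $n > 4$.
   Context: For integers $m\ge 1$, $\ell\ge 0$ and $n\ge 4$ with $n$ even and $m-\ell$ even, the honeycomb toroidal graph $\mathrm{HTG}(m,n,\ell)$ is the simple graph with vertex set $\{u_{i,j}: 0\le i\le m-1,\ 0\le j\le n-1\}$ (first subscript computed modulo $m$, second modulo $n$) whose edge set is the set of the following unordered pairs: $\{u_{i,j},u_{i,j+1}\}$ for all $i,j$ (vertical edges); $\{u_{i,j},u_{i+1,j}\}$ for all $0\le i\le m-2$ with $i+j$ odd (flat edges); and $\{u_{m-1,j},u_{0,j+\ell}\}$ for all $j$ having the same parity as $m$ (and $\ell$) (jump edges). (Repeated pairs give a single edge; thus $\mathrm{HTG}(1,n,1)$ is the $n$-cycle.) A 2-factor of a graph is a spanning subgraph in which every vertex has valency 2. A graph $X$ is 2-spanning cyclable if for every pair of distinct vertices $u,v$ of $X$ there is a 2-factor of $X$ consisting of exactly two cycles such that $u$ and $v$ lie in different cycles. *)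

(* Defs.v *)
From mathcomp Require Import all_boot.

Set Implicit Arguments.
Unset Strict Implicit.
Unset Printing Implicit Defensive.

(** A simple graph on a finite vertex type [V] is given by its set of edges
    [E : {set {set V}}]; its vertex set is all of [V]. *)

Definition simple_graph (V : finType) (E : {set {set V}}) : bool :=
  [forall e in E, #|e| == 2].

Definition valency (V : finType) (F : {set {set V}}) (v : V) : nat :=
  #|[set e in F | v \in e]|.

(** A spanning subgraph has the same vertices, hence is a subset of [E]. *)
Definition two_factor (V : finType) (E F : {set {set V}}) : bool :=
  (F \subset E) && [forall v, valency F v == 2].

(** A cycle is the cyclic sequence of its vertices. *)
Definition is_cycle (V : finType) (c : seq V) : bool := uniq c && (2 < size c).

Definition cycle_edges (V : finType) (c : seq V) : {set {set V}} :=
  [set [set x; next c x] | x in c].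

Definition two_spanning_cyclable (V : finType) (E : {set {set V}}) : Prop :=
  forall u v : V, u != v ->
  exists F : {set {set V}}, two_factor E F /\
  exists c1 c2 : seq V,
    [/\ is_cycle c1 /\ is_cycle c2, [disjoint c1 & c2],
        F = cycle_edges c1 :|: cycle_edges c2, u \in c1 & v \in c2].

Definition ord_shift (n : nat) (j : 'I_n) (l : nat) : 'I_n :=
  Ordinal (ltn_pmod (j + l) (leq_ltn_trans (leq0n j) (ltn_ord j))).

(** The pair [(i, j)] is the vertex u_{i,j}; [ordS] and [ord_shift] compute
    modulo the bound of the index. *)

Definition HTG_vertical (m n : nat) : {set {set 'I_m * 'I_n}} :=
  [set [set (i, j); (i, ordS j)] | i : 'I_m, j : 'I_n].

Definition HTG_flat (m n : nat) : {set {set 'I_m * 'I_n}} :=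
  [set [set (i, j); (ordS i, j)] | i in 'I_m, j in 'I_n
                                 & (i.+1 < m) && odd (i + j)].

(** Here [i] is m - 1, so that [ordS i] is 0. *)
Definition HTG_jump (m n l : nat) : {set {set 'I_m * 'I_n}} :=
  [set [set (i, j); (ordS i, ord_shift j l)] | i in 'I_m, j in 'I_n
                                 & (i.+1 == m) && (odd j == odd m)].

Definition HTG (m n l : nat) : {set {set 'I_m * 'I_n}} :=
  HTG_vertical m n :|: HTG_flat m n :|: HTG_jump m n l.

Lemma HTG_simple (m n l : nat) :
  1 <= m -> 4 <= n -> ~~ odd n -> odd m = odd l -> simple_graph (HTG m n l).
Proof.
move=> m1 n4 nE ml; apply/forall_inP => e.
have n1 : 1 < n by apply: leq_trans n4.
have neqS (k : nat) (x : 'I_k) : 1 < k -> x != ordS x.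
  move=> k1; rewrite -val_eqE /=.
  have := ltn_ord x; rewrite leq_eqVlt => /orP[/eqP xk|xk].
    by rewrite xk modnn -lt0n -ltnS xk.
  by rewrite modn_small // neq_ltn ltnSn.
rewrite !inE => /orP[/orP[]|] /imset2P[i j _ h ->]; rewrite cards2.
- by rewrite xpair_eqE eqxx neqS.
- move: h; rewrite inE => /andP[_ /andP[h _]].
  by rewrite xpair_eqE eqxx andbT neqS // (leq_trans _ h).
move: h; rewrite inE => /andP[_ /andP[/eqP im /eqP jm]].
rewrite xpair_eqE negb_and.
case: (ltnP 1 m) => [m2|m2]; first by rewrite neqS.
have m1E : m = 1 by apply/eqP; rewrite eqn_leq m1 m2.
rewrite [j != _](_ : _ = true) ?orbT // -val_eqE /=.
apply/eqP => /(congr1 odd); rewrite -[in LHS](modn_small (ltn_ord j)).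
have oddm (a : nat) : odd (a %% n) = odd a.
  by rewrite [in RHS](divn_eq a n) oddD oddM (negbTE nE) andbF.
by rewrite !oddm oddD -ml m1E; case: odd.
Qed.

(* Main.v *)
(** Write (i, j) for u_{i,j}, m = 2h + 3 and n = 2k + 6. The hexagon in columns
    0, 1 and rows 1, 2, 3 has a Hamiltonian complement: go through rows 0..3 of
    the columns 2, .., m - 1 in a snake, then in the same way through all the
    columns for rows 4, 5, then for rows 6, 7, and so on up to rows n - 4,
    n - 3 (each passage ends with a jump edge that leads to the next pair of
    rows), then through (0, n - 2), (0, n - 1), (0, 0), backwards through rows
    n - 2, n - 1 of the columns m - 1, .., 2, and finally through (1, n - 2),
    (1, n - 1), (1, 0). The translations (i, j) -> (i, j + 2) and
    (i, j) -> (i + 1, j + 1) are automorphisms, transitive on each colour class;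
    every vertex lies in three hexagons with no other common vertex, so some
    translate of the hexagon separates any two given vertices.

    Conversely, HTG(1, n, 1) is a cycle. For n = 4, if (0, 1)
    and (1, 1) were in different cycles of a 2-factor, then columns 0 and
    1 would each be connected in the 2-factor, so no flat edge between them is in
    it, hence both are full 4-cycles and (2, 0) is left uncovered. *)

Require Import Defs.
From mathcomp Require Import all_boot zify.

Set Implicit Arguments.
Unset Strict Implicit.
Unset Printing Implicit Defensive.

(** * Cycles, their edge sets and 2-factors in an arbitrary simple graph *)

Definition adj (V : finType) (E : {set {set V}}) : rel V :=
  fun x y => [set x; y] \in E.

Lemma adj_sym (V : finType) (E : {set {set V}}) : symmetric (adj E).
Proof. by move=> x y; rewrite /adj setUC. Qed.

(** After a rotation the cycle reads [x :: y :: z :: s]: the successor of [x] is [y], its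
    predecessor is the last entry of [z :: s], and uniqueness keeps these apart. Hence the two cycle
    edges at [x] are distinct. *)
Lemma next_neq_prev (T : eqType) (c : seq T) (x : T) :
  uniq c -> 2 < size c -> x \in c -> next c x != prev c x.
Proof.
move=> Uc c_gt2 /rot_to[k [|y [|z s]] Ec].
- by rewrite -(size_rot k) Ec in c_gt2.
- by rewrite -(size_rot k) Ec in c_gt2.
rewrite -(next_rot k) // -(prev_rot k) // Ec.
move: Uc; rewrite -(rot_uniq k) Ec => /= /and3P[+ + _].
rewrite eqxx inE => /norP[xy /[dup]]; rewrite {1}inE => /norP[xz _].
rewrite (negPf xy) (negPf xz).
elim: s z {Ec xz} => [|t s IHs] z /=.
  by rewrite !inE eqxx => _.
rewrite inE => /norP[_ xts]; rewrite inE => /norP[yz yts].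
by case: ifP => // _; apply: IHs.
Qed.

Lemma next_neq (T : eqType) (c : seq T) (x : T) :
  uniq c -> 2 < size c -> x \in c -> next c x != x.
Proof.
move=> Uc c_gt2 /rot_to[k [|y s] Ec].
  by rewrite -(size_rot k) Ec in c_gt2.
rewrite -(next_rot k) // Ec /= eqxx eq_sym.
by move: Uc; rewrite -(rot_uniq k) Ec /= inE => /andP[/norP[]].
Qed.

Lemma mem_cycle_edges (V : finType) (c : seq V) (e : {set V}) (x : V) :
  uniq c -> e \in cycle_edges c -> x \in e ->
  x \in c /\ (e = [set x; next c x] \/ e = [set prev c x; x]).
Proof.
move=> Uc /imsetP[y yc ->]; rewrite !inE => /orP[]/eqP->; first by split; [|left].
by rewrite mem_next prev_next //; split; [|right].
Qed.

Lemma cycle_edge_next (V : finType) (c : seq V) (x : V) :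
  x \in c -> [set x; next c x] \in cycle_edges c.
Proof. exact: imset_f. Qed.

Lemma cycle_edge_prev (V : finType) (c : seq V) (x : V) :
  uniq c -> x \in c -> [set prev c x; x] \in cycle_edges c.
Proof.
by move=> Uc xc; rewrite -{2}(next_prev Uc x) cycle_edge_next ?mem_prev.
Qed.

Lemma valency_cycles (V : finType) (c c' : seq V) (x : V) :
  uniq c -> uniq c' -> 2 < size c -> [disjoint c & c'] -> x \in c ->
  valency (cycle_edges c :|: cycle_edges c') x = 2.
Proof.
move=> Uc Uc' c_gt2 dcc' xc.
have neq : [set x; next c x] != [set prev c x; x].
  apply: contraNneq (next_neq_prev Uc c_gt2 xc) => /setP/(_ (next c x)).
  by rewrite !inE eqxx orbT (negPf (next_neq Uc c_gt2 xc)) orbF => /esym.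
rewrite /valency (_ : [set _ in _ | _] =
  [set [set x; next c x]; [set prev c x; x]]) ?cards2 ?neq //.
apply/setP=> e; rewrite !inE; apply/andP/orP => [[/orP[eF|eF] xe]|].
- by have [_ [->|->]] := mem_cycle_edges Uc eF xe; [left | right].
- have [xc' _] := mem_cycle_edges Uc' eF xe.
  by move: (disjointFr dcc' xc); rewrite xc'.
- by case=> /eqP->; rewrite ?cycle_edge_next ?cycle_edge_prev // !inE eqxx ?orbT.
Qed.

Lemma cycle_edges_sub (V : finType) (E : {set {set V}}) (c : seq V) :
  cycle (adj E) c -> cycle_edges c \subset E.
Proof. by move=> cE; apply/subsetP => _ /imsetP[x /(next_cycle cE) xE ->]. Qed.

(** Equal sizes make the two disjoint cycles cover all the vertices. *)
Definition separated (V : finType) (E : {set {set V}}) (u v : V) : Prop :=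
  exists c1 c2 : seq V,
    [/\ uniq (c1 ++ c2), size (c1 ++ c2) = #|V|, 2 < size c1 & 2 < size c2] /\
    [/\ cycle (adj E) c1, cycle (adj E) c2, u \in c1 & v \in c2].

Lemma separated_two_factor (V : finType) (E : {set {set V}}) (u v : V) :
  separated E u v ->
  exists F : {set {set V}}, two_factor E F /\
  exists c1 c2 : seq V,
    [/\ is_cycle c1 /\ is_cycle c2, [disjoint c1 & c2],
        F = cycle_edges c1 :|: cycle_edges c2, u \in c1 & v \in c2].
Proof.
case=> c1 [c2 [[U12 sz12 c1_gt2 c2_gt2] [c1E c2E uc1 vc2]]].
have cover x : x \in c1 ++ c2.
  suff -> : c1 ++ c2 =i V by [].
  by apply/subset_cardP; [rewrite (card_uniqP U12) | apply/subsetP].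
have /and3P[U1 hasN U2] : [&& uniq c1, ~~ has [in c1] c2 & uniq c2].
  by rewrite -cat_uniq.
have d12 : [disjoint c1 & c2] by rewrite disjoint_sym disjoint_has.
exists (cycle_edges c1 :|: cycle_edges c2); split; last first.
  by exists c1, c2; split=> //; rewrite /is_cycle U1 U2.
rewrite /two_factor subUset !cycle_edges_sub //=; apply/forallP=> x; apply/eqP.
have := cover x; rewrite mem_cat => /orP[xc|xc]; first exact: valency_cycles.
by rewrite setUC valency_cycles // disjoint_sym.
Qed.

(** A list that meets every vertex and is no longer than the vertex set has no repetition, so for
    explicit tours a covering argument and a length count replace any proof of disjointness. *)
Lemma separated_cover (V : finType) (E : {set {set V}}) (u v : V) (c1 c2 : seq V) :
  (forall x, x \in c1 ++ c2) -> size (c1 ++ c2) = #|V| ->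
  2 < size c1 -> 2 < size c2 -> cycle (adj E) c1 -> cycle (adj E) c2 ->
  u \in c1 -> v \notin c1 -> separated E u v.
Proof.
move=> cover sz12 c1_gt2 c2_gt2 c1E c2E uc1 vc1; exists c1, c2; split; split=> //.
  apply: (leq_size_uniq (enum_uniq V)) => [x _|]; first exact: cover.
  by rewrite sz12 cardE.
by have := cover v; rewrite mem_cat (negPf vc1).
Qed.

Lemma separated_hom (V : finType) (E : {set {set V}}) (f : V -> V) (u v : V) :
  injective f -> (forall e, e \in E -> f @: e \in E) ->
  separated E u v -> separated E (f u) (f v).
Proof.
move=> f_inj fE [c1 [c2 [[U12 sz12 c1_gt2 c2_gt2] [c1E c2E uc1 vc2]]]].
have f_cycle c : cycle (adj E) c -> cycle (adj E) (map f c).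
  apply: homo_cycle => x y /fE; rewrite imsetU1 imset_set1. done.
exists (map f c1), (map f c2).
by rewrite -map_cat map_inj_uniq // !size_map !f_cycle ?map_f.
Qed.

(** The map [g], acting as [f] on both coordinates, permutes a finite set, so its inverse is one of
    its iterates, and each iterate preserves separation. Thus the inverse of [f] never has to be
    studied itself. *)
Lemma separated_hom_inv (V : finType) (E : {set {set V}}) (f : V -> V) (u v : V) :
  injective f -> (forall e, e \in E -> f @: e \in E) ->
  separated E (f u) (f v) -> separated E u v.
Proof.
move=> f_inj fE.
pose g (p : V * V) := (f p.1, f p.2).
have g_inj : injective g by move=> [a b] [c d] [/f_inj -> /f_inj ->].
have sepg k p : separated E p.1 p.2 ->
    separated E (iter k g p).1 (iter k g p).2.
  by move=> sep_p; elim: k => //= k; apply: separated_hom.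
move=> /(sepg (order g (g (u, v))).-1 (g (u, v))).
by rewrite -/(finv g _) finv_f.
Qed.

(** Every entry of a cycle is an iterate of [next] applied to [x], so an invariant of [next] spreads
    over the whole cycle. *)
Lemma cycle_closed (T : finType) (c : seq T) (A : pred T) (x : T) :
  uniq c -> x \in c -> A x -> (forall y, y \in c -> A y -> A (next c y)) ->
  {in c, forall y, A y}.
Proof.
move=> Uc xc Ax Anext y; rewrite -(fconnect_cycle (cycle_next Uc) xc).
case/connectP=> p /fpathP[k ->] ->; rewrite last_traject.
suff /andP[] : (iter k (next c) x \in c) && A (iter k (next c) x) by [].
elim: k => [|k /andP[kc kA]] /=; first by rewrite xc.
by rewrite mem_next kc Anext.
Qed.

Lemma cycle_edges_mem (V : finType) (c c' : seq V) (e : {set V}) (x y : V) :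
  uniq c' -> [disjoint c & c'] -> e \in cycle_edges c :|: cycle_edges c' ->
  x \in e -> y \in e -> x \in c -> y \in c.
Proof.
move=> Uc' dcc'; rewrite inE => /orP[/imsetP[z zc ->] _|ec' xe _ xc].
  by rewrite !inE => /orP[] /eqP-> _; rewrite ?mem_next.
have [xc' _] := mem_cycle_edges Uc' ec' xe.
by rewrite (disjointFr dcc' xc) in xc'.
Qed.

Lemma valency2_other (V : finType) (F : {set {set V}}) (x : V) (f : {set V}) :
  valency F x = 2 -> exists e, [/\ e \in F, x \in e & e != f].
Proof.
rewrite /valency (cardsD1 f) => cS.
have /card_gt0P[e] : 0 < #|[set e in F | x \in e] :\ f|.
  by rewrite lt0n; apply: contra_eqN cS => /eqP->; case: (f \in _).
by rewrite !inE => /and3P[ef eF xe]; exists e.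
Qed.

Lemma valency2_pair (V : finType) (F : {set {set V}}) (x : V) (e1 e2 : {set V}) :
  valency F x = 2 -> (forall e, e \in F -> x \in e -> e = e1 \/ e = e2) ->
  e1 \in F /\ e2 \in F.
Proof.
move=> vx Fx; split.
  by have [e [eF xe]] := valency2_other e2 vx; case: (Fx e eF xe) => <- //; rewrite eqxx.
by have [e [eF xe]] := valency2_other e1 vx; case: (Fx e eF xe) => <- //; rewrite eqxx.
Qed.

Lemma valency2_only (V : finType) (F : {set {set V}}) (x : V) (e1 e2 e : {set V}) :
  valency F x = 2 -> e1 \in F -> e2 \in F -> x \in e1 -> x \in e2 -> e1 != e2 ->
  e \in F -> x \in e -> e = e1 \/ e = e2.
Proof.
rewrite /valency => vx e1F e2F xe1 xe2 e12 eF xe.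
have /eqP/setP/(_ e) : [set e1; e2] == [set e in F | x \in e].
  rewrite eqEcard vx cards2 e12 andbT; apply/subsetP=> f.
  by rewrite !inE => /orP[]/eqP->; rewrite ?e1F ?e2F.
by rewrite !inE eF xe => /orP[]/eqP->; [left | right].
Qed.

(** * Walks with prescribed ends *)

(** The list contains both ends, so pieces of a tour are joined by plain concatenation along one
    edge, and reversal swaps the ends. *)
Definition walk (T : eqType) (e : rel T) (x : T) (s : seq T) (y : T) : bool :=
  if s is z :: s' then [&& z == x, path e z s' & last z s' == y] else false.

Lemma walk_cat (T : eqType) (e : rel T) (x y x' y' : T) (s s' : seq T) :
  walk e x s y -> e y x' -> walk e x' s' y' -> walk e x (s ++ s') y'.
Proof.
case: s s' => // a s [|b s'] //= /and3P[ax aP /eqP ay] eyx /and3P[/eqP-> bP by'].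
by rewrite cat_path last_cat ax aP ay /= eyx bP.
Qed.

Lemma walk_rev (T : eqType) (e : rel T) (x y : T) (s : seq T) :
  symmetric e -> walk e x s y -> walk e y (rev s) x.
Proof.
move=> e_sym; elim: s x => // a [|b s] IHs x.
  by rewrite /= => /andP[/eqP-> /eqP->]; rewrite !eqxx.
case/and3P=> /eqP <- /= /andP[eab bP] aby; rewrite rev_cons -cats1.
apply: walk_cat (IHs b _) (_ : e b a) _; last by rewrite /= !eqxx.
  by rewrite /= eqxx bP.
by rewrite e_sym.
Qed.

Lemma walk_cycle (T : eqType) (e : rel T) (x y : T) (s : seq T) :
  walk e x s y -> e y x -> cycle e s.
Proof.
by case: s => // a s /= /and3P[/eqP<- aP /eqP<-]; rewrite rcons_path aP.
Qed.

(** * Vertices with natural-number coordinates, and columns *)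

(** Here [m] and [n] are the last column and the last row. Since indices are reduced, a row may run
    past [n]; row [n.+1] is row 0. *)
Definition vtx (m n i j : nat) : 'I_m.+1 * 'I_n.+1 :=
  (Ordinal (ltn_pmod i (ltn0Sn m)), Ordinal (ltn_pmod j (ltn0Sn n))).

Lemma vtx_val (m n : nat) (i : 'I_m.+1) (j : 'I_n.+1) : (i, j) = vtx m n i j.
Proof. by congr pair; apply: val_inj; rewrite /= modn_small. Qed.

Lemma vtxP (m n : nat) (x : 'I_m.+1 * 'I_n.+1) :
  exists i j, [/\ i < m.+1, j < n.+1 & x = vtx m n i j].
Proof. by case: x => i j; exists i, j; rewrite -vtx_val. Qed.

Lemma vtx_eqE (m n i j i' j' : nat) :
  (vtx m n i j == vtx m n i' j') =
  (i == i' %[mod m.+1]) && (j == j' %[mod n.+1]).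
Proof. by []. Qed.

Lemma vtx_wrap (m n i : nat) : vtx m n i n.+1 = vtx m n i 0.
Proof. by apply/eqP; rewrite vtx_eqE modnn mod0n !eqxx. Qed.

Lemma ordS_vtx (m n i j : nat) :
  ((vtx m n i j).1, ordS (vtx m n i j).2) = vtx m n i j.+1.
Proof.
by congr pair; apply: val_inj; rewrite /= -addn1 modnDml addn1.
Qed.

Section Columns.

Context (m n : nat).
Local Notation vtx := (vtx m n).

Definition col_seg (i r d : nat) := [seq vtx i j | j <- iota r d].

(** A snake, upwards in even positions and downwards in odd ones. The number of columns is odd, so
    it ends in the top row of its last column. *)
Fixpoint strand (r d i h : nat) :=
  if h is h'.+1 then col_seg i r d ++ rev (col_seg i.+1 r d) ++ strand r d i.+2 h'
  else col_seg i r d.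

(** The columns are 0, .., [m], so that for even [m] these strands run through
    all of them. *)
Fixpoint spiral (r k : nat) :=
  if k is k'.+1 then strand r 2 0 m./2 ++ spiral r.+2 k' else col_seg 0 r 3.

Lemma size_strand r d i h : size (strand r d i h) = d * h.*2.+1.
Proof.
elim: h i => [|h IHh] i; rewrite /= ?size_cat ?size_rev ?IHh !size_map !size_iota; lia.
Qed.

Lemma size_spiral r k : ~~ odd m -> size (spiral r k) = k.*2 * m.+1 + 3.
Proof.
move=> m_even; elim: k r => [|k IHk] r //=.
rewrite size_cat size_strand IHk; lia.
Qed.

Lemma mem_col_seg i r d j : r <= j < r + d -> vtx i j \in col_seg i r d.
Proof. by move=> rj; apply: map_f; rewrite mem_iota. Qed.

Lemma mem_strand r d a h i j :
  a <= i <= a + h.*2 -> r <= j < r + d -> vtx i j \in strand r d a h.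
Proof.
elim: h a => [|h IHh] a /= ia rj.
  have -> : i = a by lia.
  exact: mem_col_seg.
rewrite !mem_cat mem_rev; have [->|nia] := eqVneq i a; first by rewrite mem_col_seg.
have [->|nia1] := eqVneq i a.+1; first by rewrite mem_col_seg // orbT.
by rewrite IHh ?orbT //; lia.
Qed.

Lemma mem_spiral r k i j :
  ~~ odd m -> i <= m -> r <= j < r + k.*2 -> vtx i j \in spiral r k.
Proof.
move=> m_even; elim: k r => [|k IHk] r /= im rj; first by lia.
rewrite mem_cat; case: (ltnP j r.+2) => rj2; last by rewrite IHk ?orbT //; lia.
by rewrite mem_strand //; lia.
Qed.

Lemma mem_spiral_end r k j :
  r + k.*2 <= j < r + k.*2 + 3 -> vtx 0 j \in spiral r k.
Proof.
elim: k r => [|k IHk] r rj; first by apply: mem_col_seg; lia.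
by rewrite /= mem_cat IHk ?orbT //; lia.
Qed.

Lemma vtxS_eq (i i' j j' : nat) :
  (vtx i j.+1 == vtx i' j'.+1) = (vtx i j == vtx i' j').
Proof. by rewrite !vtx_eqE -(addn1 j) -(addn1 j') eqn_modDr. Qed.

Lemma vertical_at (i j i' j' : nat) :
  vtx i j.+1 \in [set vtx i' j'; vtx i' j'.+1] ->
  [set vtx i' j'; vtx i' j'.+1] = [set vtx i j.+1; vtx i j.+2] \/
  [set vtx i' j'; vtx i' j'.+1] = [set vtx i j; vtx i j.+1].
Proof.
rewrite !inE => /orP[] eq1; [left | right].
  by move: (eq1); rewrite -vtxS_eq => /eqP->; rewrite (eqP eq1).
by move: (eq1); rewrite vtxS_eq => /eqP->; rewrite (eqP eq1).
Qed.

(** With at least three rows, j differs from j + 1 and j + 2 modulo the number of rows, so the lower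
    end of the first edge is not on the second. *)
Lemma vertical_neq (i j : nat) : 1 < n ->
  [set vtx i j; vtx i j.+1] != [set vtx i j.+1; vtx i j.+2].
Proof.
move=> n_gt1; apply/eqP=> /setP/(_ (vtx i j)); rewrite !inE eqxx /= !vtx_eqE eqxx /=.
have neq d : 0 < d < n.+1 -> (j == j + d %[mod n.+1]) = false.
  by move=> /andP[d0 dn]; rewrite -{1}(addn0 j) eqn_modDl mod0n modn_small; lia.
by rewrite -(addn1 j) -[(j + 1).+1]addnS !neq //; lia.
Qed.

(** The two vertical edges already exhaust the valency at each vertex of the column, so a cycle of
    the factor that enters it can never leave. *)
Lemma column_closed (F : {set {set 'I_m.+1 * 'I_n.+1}}) (i : nat)
    (c c' : seq ('I_m.+1 * 'I_n.+1)) (x : 'I_m.+1 * 'I_n.+1) :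
  1 < n -> (forall y, valency F y = 2) ->
  F = cycle_edges c :|: cycle_edges c' -> uniq c ->
  (forall j, [set vtx i j; vtx i j.+1] \in F) ->
  x \in c -> x.1 = (vtx i 0).1 -> {in c, forall y, y.1 = (vtx i 0).1}.
Proof.
move=> n_gt1 vF FE Uc vertF xc xi y yc; apply/eqP; move: y yc.
apply: (@cycle_closed _ c (fun z => z.1 == (vtx i 0).1) x) => //; first exact/eqP.
move=> y yc /eqP yi.
have [j yE] : exists j, y = vtx i j.+1.
  (* The row [y.2 + n] is the cyclic predecessor of [y.2]; the successor form [j.+1] makes both
     vertical edges at [y] expressible. *)
  exists (y.2 + n); rewrite -addnS [y]surjective_pairing /=.
  by congr pair; rewrite ?yi; apply: val_inj; rewrite //= modnDr modn_small.
have eF : [set y; next c y] \in F by rewrite FE inE cycle_edge_next.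
have := valency2_only (vF y) (vertF j) (vertF j.+1) _ _ (vertical_neq i j n_gt1) eF.
rewrite yE !inE !eqxx ?orbT => /(_ isT isT isT).
rewrite -yE; case=> /setP/(_ (next c y)); rewrite !inE eqxx orbT => /esym /orP[] /eqP->;
  rewrite // ?yi ?eqxx //.
Qed.

End Columns.

(** * Edges for an odd number of columns and an even number of rows *)

Section Edges.

Context (m n : nat) (m_even : ~~ odd m) (n_odd : odd n).
Local Notation E := (HTG m.+1 n.+1 1).
Local Notation vtx := (vtx m n).

Lemma odd_mod (j : nat) : odd (j %% n.+1) = odd j.
Proof. by rewrite [in RHS](divn_eq j n.+1) oddD oddM /= n_odd andbF. Qed.

Lemma edge_vertical (i j : nat) : adj E (vtx i j) (vtx i j.+1).
Proof.
rewrite /adj !inE; apply/orP; left; apply/orP; left; apply/imset2P.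
by exists (vtx i j).1 (vtx i j).2; rewrite // ordS_vtx.
Qed.

Lemma edge_flat (i j : nat) : i < m -> odd (i + j) -> adj E (vtx i j) (vtx i.+1 j).
Proof.
move=> im oij; rewrite /adj !inE; apply/orP; left; apply/orP; right; apply/imset2P.
have i_small : i %% m.+1 = i by rewrite modn_small // ltnW.
exists (vtx i j).1 (vtx i j).2 => //.
  by rewrite inE /= i_small ltnS im oddD odd_mod -oddD.
congr [set _; _]; congr pair; apply: val_inj => //=.
by rewrite i_small.
Qed.

Lemma edge_jump (j : nat) : odd j -> adj E (vtx m j) (vtx 0 j.+1).
Proof.
move=> oj; rewrite /adj !inE; apply/orP; right; apply/imset2P.
exists (vtx m j).1 (vtx m j).2 => //.
  by rewrite inE /= modn_small // eqxx odd_mod oj m_even.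
congr [set _; _]; congr pair; apply: val_inj => /=.
  by rewrite [m %% _]modn_small // modnn.
by rewrite modnDml addn1.
Qed.

Lemma HTG_edgeP (e : {set 'I_m.+1 * 'I_n.+1}) : e \in E ->
  [\/ exists i j, i <= m /\ e = [set vtx i j; vtx i j.+1],
      exists i j, [/\ i < m, odd (i + j) & e = [set vtx i j; vtx i.+1 j]] |
      exists j, odd j /\ e = [set vtx m j; vtx 0 j.+1]].
Proof.
rewrite !inE => /orP[/orP[]|] /imset2P[i j _ h ->].
- apply: Or31; exists i, j; split; first by rewrite -ltnS.
  by rewrite -ordS_vtx -vtx_val.
- move: h; rewrite inE /= ltnS => /andP[im oij].
  apply: Or32; exists i, j; split=> //.
  congr [set _; _]; congr pair; apply: val_inj; rewrite /= ?modn_small //.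
move: h; rewrite inE /= m_even eqSS => /andP[/eqP im /eqP oj].
apply: Or33; exists j; split=> //.
congr [set _; _]; congr pair; apply: val_inj => /=.
- by rewrite im modn_small.
- by rewrite modn_small.
- by rewrite im modnn.
by rewrite addn1.
Qed.

(** * The two translations *)

Definition shift2 (x : 'I_m.+1 * 'I_n.+1) := vtx x.1 x.2.+2.

(** The jump edges have offset 1, so that the translation by (1, 1) gains one
    more row when it leaves the last column. *)
Definition shift_diag (x : 'I_m.+1 * 'I_n.+1) :=
  if x.1 < m then vtx x.1.+1 x.2.+1 else vtx 0 x.2.+2.

Lemma vtx_modr i a j : vtx i (a + j %% n.+1) = vtx i (a + j).
Proof. by apply/eqP; rewrite vtx_eqE modnDmr !eqxx. Qed.

Lemma shift2E (i j : nat) : shift2 (vtx i j) = vtx i j.+2.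
Proof.
by rewrite /shift2 -add2n vtx_modr add2n; apply/eqP; rewrite vtx_eqE /= modn_mod !eqxx.
Qed.

Lemma shift_diagE (i j : nat) : i < m -> shift_diag (vtx i j) = vtx i.+1 j.+1.
Proof.
move=> im; rewrite /shift_diag /= [i %% _]modn_small ?im; last exact: ltnW.
by rewrite -(add1n (j %% n.+1)) vtx_modr.
Qed.

Lemma shift_diag_last (j : nat) : shift_diag (vtx m j) = vtx 0 j.+2.
Proof.
by rewrite /shift_diag /= [m %% _]modn_small // ltnn -(add2n (j %% n.+1)) vtx_modr.
Qed.

Lemma shift2_inj : injective shift2.
Proof.
move=> [i j] [i' j'] /eqP; rewrite vtx_eqE /= -!(addn2 (nat_of_ord _)) eqn_modDr.
rewrite !modn_small // => /andP[/eqP ii /eqP jj].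
by congr pair; apply: val_inj.
Qed.

Lemma shift_diag_inj : injective shift_diag.
Proof.
move=> [i j] [i' j']; rewrite /shift_diag /=.
have := ltn_ord i; have := ltn_ord i'; rewrite !ltnS => i'm im.
case: ltnP => [im1|mi]; case: ltnP => [im1'|mi'] /eqP; rewrite vtx_eqE.
- rewrite -!(addn1 (nat_of_ord _)) !eqn_modDr !modn_small // => /andP[/eqP ii /eqP jj].
  by congr pair; apply: val_inj.
- by rewrite mod0n modn_small.
- by rewrite mod0n modn_small.
rewrite eqxx /= -!(addn2 (nat_of_ord _)) eqn_modDr !modn_small // => /eqP jj.
congr pair; apply: val_inj => //=.
by apply/eqP; rewrite eqn_leq (leq_trans im mi') (leq_trans i'm mi).
Qed.

Lemma shift2_hom (e : {set 'I_m.+1 * 'I_n.+1}) : e \in E -> shift2 @: e \in E.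
Proof.
case/HTG_edgeP=> [[i [j [_ ->]]]|[i [j [im oij ->]]]|[j [oj ->]]];
  rewrite imsetU1 imset_set1 !shift2E.
- exact: edge_vertical.
- by apply: edge_flat; rewrite // !addnS /= negbK.
by apply: edge_jump; rewrite /= negbK.
Qed.

(** Edge types are not preserved: a flat edge into the last column becomes a jump edge, and a jump
    edge becomes a flat edge between columns 0 and 1. The parity conditions match because [m] is
    even. *)
Lemma shift_diag_hom (e : {set 'I_m.+1 * 'I_n.+1}) :
  0 < m -> e \in E -> shift_diag @: e \in E.
Proof.
move=> m_gt0; case/HTG_edgeP=> [[i [j [im ->]]]|[i [j [im oij ->]]]|[j [oj ->]]];
  rewrite imsetU1 imset_set1.
- move: im; rewrite leq_eqVlt => /predU1P[->|im].
    by rewrite !shift_diag_last; apply: edge_vertical.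
  by rewrite !shift_diagE //; apply: edge_vertical.
- rewrite shift_diagE //; case: (ltnP i.+1 m) => [im1|mi].
    by rewrite shift_diagE //; apply: edge_flat; rewrite // addSn addnS /= negbK.
  have mE : m = i.+1 by apply/eqP; rewrite eqn_leq mi im.
  rewrite -[in shift_diag _]mE shift_diag_last -[in vtx i.+1]mE.
  by apply: edge_jump; move: oij m_even; rewrite mE oddD /=; case: odd.
rewrite shift_diag_last shift_diagE //.
by apply: edge_flat; rewrite //= negbK.
Qed.


(** * Walks through columns, and the edges at an end of a flat edge *)

Local Notation col_seg := (col_seg m n).
Local Notation strand := (strand m n).
Local Notation spiral := (spiral m n).
Local Notation walk := (walk (adj E)).

Lemma walk_col_seg i r d : walk (vtx i r) (col_seg i r d.+1) (vtx i (r + d)).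
Proof.
rewrite /= eqxx; elim: d r => [|d IHd] r /=; first by rewrite addn0 eqxx.
by have := IHd r.+1; rewrite edge_vertical // addSnnS.
Qed.

(** The parities are those that put a flat edge at each turn: from an even column at the odd top
    row, from an odd column at the even bottom row. *)
Lemma walk_strand r d a h : ~~ odd r -> odd d -> ~~ odd a -> a + h.*2 <= m ->
  walk (vtx a r) (strand r d.+1 a h) (vtx (a + h.*2) (r + d)).
Proof.
move=> r_even d_odd; elim: h a => [|h IHh] a a_even ahm; rewrite [strand _ _ _ _]/=.
  by rewrite addn0 walk_col_seg.
apply: walk_cat (walk_col_seg _ _ _) _ _; last first.
  apply: walk_cat (walk_rev (@adj_sym _ _) (walk_col_seg _ _ _)) _ _.
    by apply: edge_flat; lia.
  have -> : a + h.+1.*2 = a.+2 + h.*2 by lia.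
  by apply: IHh; lia.
by apply: edge_flat; lia.
Qed.

(** Each strand ends in column [m] at the odd row r + 1, where a jump edge leads to column 0 and row
    r + 2, the start of the next strand. *)
Lemma walk_spiral r k : ~~ odd r ->
  walk (vtx 0 r) (spiral r k) (vtx 0 (r + k.*2 + 2)).
Proof.
elim: k r => [|k IHk] r r_even; first by rewrite addn0; apply: walk_col_seg.
have -> : r + k.+1.*2 + 2 = r.+2 + k.*2 + 2 by lia.
rewrite [spiral _ _]/=; apply: walk_cat (walk_strand _ _ _ _) _ (IHk _ _); try lia.
have -> : 0 + m./2.*2 = m by lia.
by rewrite addn1; apply: edge_jump; lia.
Qed.

Lemma vtx_inj (i i' j j' : nat) :
  i <= m -> i' <= m -> vtx i j = vtx i' j' -> i = i' /\ odd j = odd j'.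
Proof.
move=> im im' /eqP; rewrite vtx_eqE !(@modn_small _ m.+1) // => /andP[/eqP-> /eqP jj'].
by rewrite -odd_mod jj' odd_mod.
Qed.

(** The graph is cubic: an end of a flat edge meets that edge and two vertical ones. Jump edges are
    excluded by parity, as they leave column [m] at odd rows and reach column 0 at even rows, while
    flat edges use the opposite parity in these columns. *)
Lemma edge_at_flat (e : {set 'I_m.+1 * 'I_n.+1}) (i i' j : nat) :
  i < m -> odd (i + j.+1) -> i' = i \/ i' = i.+1 -> e \in E -> vtx i' j.+1 \in e ->
  [\/ e = [set vtx i j.+1; vtx i.+1 j.+1], e = [set vtx i' j.+1; vtx i' j.+2] |
      e = [set vtx i' j; vtx i' j.+1]].
Proof.
move=> im oij ii'; have i'm : i' <= m by lia.
case/HTG_edgeP=> [[a [b [_ ->]]] | [a [b [am oab ->]]] | [b [ob ->]]].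
- by case/vertical_at=> ->; [apply: Or32 | apply: Or33].
- rewrite !inE => /orP[] /eqP xE; apply: Or31.
    have [ai' ojb] := vtx_inj i'm (ltnW am) xE; have ai : a = i by lia.
    move: xE => /eqP; rewrite vtx_eqE => /andP[_ jb].
    by rewrite ai; congr [set _; _]; apply/eqP; rewrite vtx_eqE eqxx eq_sym.
  have [ai' ojb] := vtx_inj i'm am xE; have ai : a = i by lia.
  move: xE => /eqP; rewrite vtx_eqE => /andP[_ jb].
  by rewrite ai; congr [set _; _]; apply/eqP; rewrite vtx_eqE eqxx eq_sym.
rewrite !inE => /orP[] /eqP xE.
  by have [] := vtx_inj i'm (leqnn m) xE; lia.
by have [] := vtx_inj i'm (leq0n m) xE; rewrite /=; lia.
Qed.

End Edges.

(** * Sufficiency: the hexagon, its Hamiltonian complement and their translates *)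

Section Factor.

Context (h k : nat).
Local Notation m := h.*2.+2.
Local Notation n := (k.*2 + 5).
Local Notation E := (HTG m.+1 n.+1 1).
Local Notation vtx := (vtx m n).

Definition hexagon := col_seg m n 0 1 3 ++ rev (col_seg m n 1 1 3).

(** As [n] is the last row, [n.-1] is the second to last. The spiral ends with rows [n.-1], [n],
    [n.+1] of column 0, since 4 + 2k = n - 1; the final segment has the same rows in column 1. Row
    [n.+1] wraps to row 0. *)
Definition cohexagon :=
  strand m n 0 4 2 h ++ spiral m n 4 k ++ rev (strand m n n.-1 2 2 h)
    ++ col_seg m n 1 n.-1 3.

Let m_even : ~~ odd m. Proof. by lia. Qed.
Let n_odd : odd n. Proof. by lia. Qed.

Lemma hexagon_cycle : cycle (adj E) hexagon.
Proof.
apply: (@walk_cycle _ _ (vtx 0 1) (vtx 1 1)); last first.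
  by rewrite adj_sym; apply: edge_flat.
apply: walk_cat (walk_col_seg _ _ _ _ _) _ _; last first.
  by apply: walk_rev (walk_col_seg _ _ _ _ _); apply: adj_sym.
by apply: edge_flat.
Qed.

Lemma cohexagon_cycle : cycle (adj E) cohexagon.
Proof.
have hm : 2 + h.*2 = m by [].
have n1_even : ~~ odd n.-1 by lia.
have nE : n.-1 + 2 = n.+1 by lia.
apply: (@walk_cycle _ _ (vtx 2 0) (vtx 1 (n.-1 + 2))); last first.
  (* The closing flat edge joins (1, 0) to (2, 0). *)
  by rewrite nE vtx_wrap; apply: edge_flat.
apply: walk_cat (walk_strand _ _ _ _ _ _) _ _; rewrite ?hm //.
  exact: edge_jump.
apply: walk_cat (walk_spiral _ _ _ _) _ _ => //.
  (* From (0, 0), written as row [n.+1], the tour runs a jump edge backwards to the last row of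
     column [m]. *)
  rewrite (_ : 4 + _ + 2 = n.-1 + 1 + 1); last by lia.
  rewrite addn1 adj_sym; apply: edge_jump => //; lia.
apply: walk_cat (walk_rev (@adj_sym _ _) (walk_strand _ _ _ _ _ _)) _
  (walk_col_seg _ _ _ _ _); rewrite ?hm //.
by rewrite adj_sym; apply: edge_flat; lia.
Qed.

Lemma hexagon_cover (x : 'I_m.+1 * 'I_n.+1) : x \in hexagon ++ cohexagon.
Proof.
have [i [j [im jn ->]]] := vtxP x; rewrite !mem_cat !mem_rev.
case: (ltnP i 2) => i2.
  have [i0|i1] : i = 0 \/ i = 1 by lia.
    case: j => [|j] in jn *.
      (* Row 0 of column 0 occurs in the tour as row [n.+1]; likewise for column 1 below. *)
      by rewrite i0 -vtx_wrap mem_spiral_end ?orbT //; lia.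
    case: (ltnP j.+1 4) => j4; first by rewrite i0 mem_col_seg.
    case: (ltnP j.+1 n.-1) => jn1; first by rewrite mem_spiral ?orbT //; lia.
    by rewrite i0 mem_spiral_end ?orbT //; lia.
  case: j => [|j] in jn *.
    by rewrite i1 -vtx_wrap (@mem_col_seg _ _ _ n.-1) ?orbT //; lia.
  case: (ltnP j.+1 4) => j4; first by rewrite i1 (@mem_col_seg _ _ _ 1) ?orbT.
  case: (ltnP j.+1 n.-1) => jn1; first by rewrite mem_spiral ?orbT //; lia.
  by rewrite i1 (@mem_col_seg _ _ _ n.-1) ?orbT //; lia.
case: (ltnP j 4) => j4.
  by rewrite (@mem_strand _ _ 0 4) ?orbT //; lia.
case: (ltnP j n.-1) => jn1; first by rewrite mem_spiral ?orbT //; lia.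
by rewrite (@mem_strand _ _ n.-1 2) ?orbT //; lia.
Qed.

Lemma size_hexagons : size (hexagon ++ cohexagon) = #|{: 'I_m.+1 * 'I_n.+1}|.
Proof.
rewrite card_prod !card_ord /cohexagon !size_cat !size_rev !size_strand size_spiral //=.
nia.
Qed.

Lemma separated_hexagon (u v : 'I_m.+1 * 'I_n.+1) :
  u \in hexagon -> v \notin hexagon -> separated E u v.
Proof.
apply: (separated_cover hexagon_cover size_hexagons) => //.
- rewrite /cohexagon !size_cat size_map size_iota; lia.
- exact: hexagon_cycle.
exact: cohexagon_cycle.
Qed.

Lemma mem_hexagon (i j : nat) :
  i <= m -> j <= n -> (vtx i j \in hexagon) = (i < 2) && (0 < j < 4).
Proof.
move=> im jn; rewrite /hexagon /col_seg /rev /= !inE !vtx_eqE.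
by rewrite !modn_small; lia.
Qed.

Lemma separated_shift2 (u v : 'I_m.+1 * 'I_n.+1) :
  separated E (shift2 u) (shift2 v) -> separated E u v.
Proof. exact: separated_hom_inv (@shift2_inj m n) (shift2_hom m_even n_odd). Qed.

Lemma separated_shift_diag (u v : 'I_m.+1 * 'I_n.+1) :
  separated E (shift_diag u) (shift_diag v) -> separated E u v.
Proof.
apply: separated_hom_inv; first exact: shift_diag_inj.
by move=> e; apply: shift_diag_hom.
Qed.

(** Only a [v] inside the hexagon needs a translation. The diagonal one keeps (0, 1) inside and
    moves (1, 1) out; for the other four vertices the shift by two rows sends (0, 1) to (0, 3) and
    [v] to row 4 or 5. *)
Lemma separated_odd (v : 'I_m.+1 * 'I_n.+1) : vtx 0 1 != v -> separated E (vtx 0 1) v.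
Proof.
have [i [j [im jn ->]]] := vtxP v => uv; rewrite !ltnS in im jn.
have [|vH] := boolP (vtx i j \in hexagon); last first.
  by apply: separated_hexagon; rewrite // mem_hexagon //; lia.
rewrite mem_hexagon // => ij.
have [/andP[/eqP-> /eqP->]|nij] := boolP ((i == 1) && (j == 1)).
  apply: separated_shift_diag; rewrite !shift_diagE //.
  by apply: separated_hexagon; rewrite mem_hexagon //; lia.
have nij0 : (i == 0) && (j == 1) = false.
  by apply: contraNF uv => /andP[/eqP-> /eqP->].
apply: separated_shift2; rewrite !shift2E.
by apply: separated_hexagon; rewrite mem_hexagon //; lia.
Qed.

(** The diagonal translation takes (0, 2) to (1, 3), still in the hexagon, and moves every other
    vertex of the hexagon out except (0, 1), which goes to (1, 2). The pair (1, 3), (1, 2) is the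
    shift by two rows of (1, 1), (1, 0), which the hexagon separates. *)
Lemma separated_even (v : 'I_m.+1 * 'I_n.+1) : vtx 0 2 != v -> separated E (vtx 0 2) v.
Proof.
have [i [j [im jn ->]]] := vtxP v => uv; rewrite !ltnS in im jn.
have [|vH] := boolP (vtx i j \in hexagon); last first.
  by apply: separated_hexagon; rewrite // mem_hexagon //; lia.
rewrite mem_hexagon // => ij.
have nij0 : (i == 0) && (j == 2) = false.
  by apply: contraNF uv => /andP[/eqP-> /eqP->].
apply: separated_shift_diag; rewrite !shift_diagE; try lia.
have [/andP[/eqP-> /eqP->]|nij] := boolP ((i == 0) && (j == 1)).
  have := separated_hom (@shift2_inj m n) (shift2_hom m_even n_odd)
    (_ : separated E (vtx 1 1) (vtx 1 0)).
  rewrite !shift2E; apply.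
  by apply: separated_hexagon; rewrite mem_hexagon //; lia.
by apply: separated_hexagon; rewrite mem_hexagon //; lia.
Qed.

Lemma separated_all (u v : 'I_m.+1 * 'I_n.+1) : u != v -> separated E u v.
Proof.
(* If [u'] is separated from all other vertices, so is its image [f u'], because the bijection [f]
   reaches every [v']. *)
have transport (f : 'I_m.+1 * 'I_n.+1 -> 'I_m.+1 * 'I_n.+1) u' v' :
    injective f -> (forall e, e \in E -> f @: e \in E) ->
    (forall v, u' != v -> separated E u' v) -> f u' != v' -> separated E (f u') v'.
  move=> f_inj fE sep_u; rewrite -(f_finv f_inj v') inj_eq // => uv.
  by apply: separated_hom => //; apply: sep_u.
have [i [j [im _ ->]]] := vtxP u.
elim: i => [|i IHi] in j v im *; last first.
  (* Adding [n] to the row undoes the increment by one modulo [n.+1]. *)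
  have -> : vtx i.+1 j = shift_diag (vtx i (j + n)).
    rewrite shift_diagE //; apply/eqP; rewrite vtx_eqE eqxx /=.
    by rewrite -(addSn j n) addSnnS modnDr.
  apply: transport; first exact: shift_diag_inj.
    by move=> e; apply: shift_diag_hom.
  by move=> w; apply: IHi; apply: ltnW.
have pos : forall j, 0 < j -> forall v, vtx 0 j != v -> separated E (vtx 0 j) v.
  move=> {}j; elim/ltn_ind: j => -[|[|[|j]]] // IHj _ w.
  - exact: separated_odd.
  - exact: separated_even.
  rewrite -[vtx 0 _]shift2E; apply: transport; first exact: shift2_inj.
    by move=> e; apply: shift2_hom.
  by apply: IHj.
(* Row 0 is treated as the positive row [n.+1]. *)
by case: j => [|j]; rewrite -?vtx_wrap; apply: pos.
Qed.

End Factor.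

(** * Necessity: a single column, then four rows *)

Lemma HTG1_not_cyclable (n : nat) :
  odd n -> 1 < n -> ~ two_spanning_cyclable (HTG 1 n.+1 1).
Proof.
move=> n_odd n_gt1 /(_ (vtx 0 n 0 0) (vtx 0 n 0 1)) [].
  by rewrite vtx_eqE eqxx mod0n modn_small // ltnS ltnW.
move=> F [/andP[/subsetP FE /forallP vF]].
move=> [c1 [c2 [[/andP[U1 _] /andP[U2 _]] d12 Fc uc1 vc2]]].
have [_ e01] :
    [set vtx 0 n 0 1; vtx 0 n 0 2] \in F /\ [set vtx 0 n 0 0; vtx 0 n 0 1] \in F.
  apply: (valency2_pair (eqP (vF (vtx 0 n 0 1)))) => e /FE.
  (* With one column there are no flat edges, and a jump edge has the same ends as a vertical one,
     so (0, 1) has only two edges and both are forced into [F]. *)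
  case/(HTG_edgeP (isT : ~~ odd 0)) => [[i [j [i0 ->]]]|[i [j []]]|[j [_ ->]]] //;
    exact: vertical_at.
have vc1 : vtx 0 n 0 1 \in c1.
  rewrite Fc in e01.
  by apply: (cycle_edges_mem U2 d12 e01 _ _ uc1); rewrite !inE eqxx ?orbT.
by rewrite (disjointFr d12 vc1) in vc2.
Qed.

Section FourRows.

Context (m : nat) (m_even : ~~ odd m) (m_gt0 : 0 < m).
Local Notation E := (HTG m.+1 4 1).
Local Notation vtx := (vtx m 3).

Lemma vertical_pair (F : {set {set 'I_m.+1 * 'I_4}}) (i j : nat) :
  F \subset E -> (forall y, valency F y = 2) -> i = 0 \/ i = 1 -> ~~ odd j ->
  [set vtx 0 j.+1; vtx 1 j.+1] \notin F ->
  [set vtx i j.+1; vtx i j.+2] \in F /\ [set vtx i j; vtx i j.+1] \in F.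
Proof.
move=> /subsetP FE vF i01 j_even nF.
apply: (valency2_pair (vF (vtx i j.+1))) => e eF ie.
have [ee|->|->] := edge_at_flat m_even (isT : odd 3) m_gt0 j_even i01 (FE e eF) ie.
- by rewrite -ee eF in nF.
- by left.
by right.
Qed.

(** Without the flat edge in row 1, [F] joins (i, 1) to rows 0 and 2. Some edge of [F] at (i, 3) is
    not the flat one, so it leads to row 2 or to row 4, which is row 0; either way it reaches the
    cycle of (i, 1). *)
Lemma column_connected (F : {set {set 'I_m.+1 * 'I_4}})
    (c c' : seq ('I_m.+1 * 'I_4)) (i : nat) :
  F \subset E -> (forall y, valency F y = 2) -> F = cycle_edges c :|: cycle_edges c' ->
  uniq c' -> [disjoint c & c'] -> i = 0 \/ i = 1 ->
  [set vtx 0 1; vtx 1 1] \notin F -> vtx i 1 \in c -> vtx i 3 \in c.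
Proof.
move=> FE vF Fc Uc' dcc' i01 nF ic.
have [e12 e01] := @vertical_pair F i 0 FE vF i01 isT nF.
have clos x y : [set x; y] \in F -> x \in c -> y \in c.
  by rewrite Fc => xyF; apply: (cycle_edges_mem Uc' dcc' xyF); rewrite !inE eqxx ?orbT.
have [e [eF ie ne]] := valency2_other [set vtx 0 3; vtx 1 3] (vF (vtx i 3)).
have [ee|ee|ee] := edge_at_flat m_even (isT : odd 3) m_gt0 (isT : odd (0 + 3)) i01
  (subsetP FE e eF) ie.
- by rewrite ee eqxx in ne.
- apply: (clos (vtx i 4)); first by rewrite setUC -ee.
  by rewrite vtx_wrap; apply: clos ic; rewrite setUC.
by apply: (clos (vtx i 2)); [rewrite -ee | apply: clos ic].
Qed.

Lemma HTG4_not_cyclable : ~ two_spanning_cyclable E.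
Proof.
have m_gt1 : 1 < m by lia.
move=> /(_ (vtx 0 1) (vtx 1 1)) [].
  by rewrite vtx_eqE mod0n modn_small.
move=> F [/andP[FE /forallP vF']].
move=> [c1 [c2 [[/andP[U1 _] /andP[U2 _]] d12 Fc uc1 vc2]]].
have vF y : valency F y = 2 by apply/eqP.
have d21 : [disjoint c2 & c1] by rewrite disjoint_sym.
have Fc' : F = cycle_edges c2 :|: cycle_edges c1 by rewrite setUC.
have no_flat j : vtx 0 j \in c1 -> vtx 1 j \in c2 -> [set vtx 0 j; vtx 1 j] \notin F.
  move=> jc1 jc2; apply/negP; rewrite Fc => jF.
  suff jc1' : vtx 1 j \in c1 by rewrite (disjointFr d12 jc1') in jc2.
  by apply: (cycle_edges_mem U2 d12 jF _ _ jc1); rewrite !inE eqxx ?orbT.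
have nF1 := no_flat 1 uc1 vc2.
have nF3 : [set vtx 0 3; vtx 1 3] \notin F.
  apply: no_flat; first by apply: column_connected nF1 uc1; eauto.
  by apply: column_connected nF1 vc2; eauto.
(* Rows 1 and 3 both lack their flat edge, and the vertical edges at these two rows are all four
   edges of the column. *)
have vertF i j : i = 0 \/ i = 1 -> [set vtx i j; vtx i j.+1] \in F.
  move=> i01.
  have [e12 e01] := @vertical_pair F i 0 FE vF i01 isT nF1.
  have [e34 e23] := @vertical_pair F i 2 FE vF i01 isT nF3.
  have jE a : vtx i (j + a) = vtx i (j %% 4 + a).
    by apply/eqP; rewrite vtx_eqE modnDml !eqxx.
  rewrite -(addn0 j) -addnS !jE.
  by case: (j %% 4) (ltn_pmod j (isT : 0 < 4)) => [|[|[|[|]]]].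
have col1 := column_closed (isT : 1 < 3) vF Fc U1
  (fun j => vertF 0 j (or_introl erefl)) uc1 erefl.
have col2 := column_closed (isT : 1 < 3) vF Fc' U2
  (fun j => vertF 1 j (or_intror erefl)) vc2 erefl.
(* The edge [set0] is a dummy, as any edge of [F] at (2, 0) will do. Column 2 exists because [m] is
   even and positive. *)
have [e [eF xe _]] := valency2_other set0 (vF (vtx 2 0)).
have : (vtx 2 0 \in c1) || (vtx 2 0 \in c2).
  move: eF; rewrite Fc inE => /orP[] eF; apply/orP; [left | right];
    by have [] := mem_cycle_edges _ eF xe.
by case/orP=> [/col1|/col2] /(congr1 val) /=; rewrite !modn_small //; lia.
Qed.

End FourRows.

Theorem theorem4p1 (m n : nat) (m_ge1 : 1 <= m) (m_odd : odd m)
    (n_ge4 : 4 <= n) (n_even : ~~ odd n) :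
  two_spanning_cyclable (HTG m n 1) <-> 3 <= m /\ 4 < n.
Proof.
split=> [cyc|[m_ge3 n_gt4]]; last first.
  have [h ->] : exists h, m = h.*2.+3 by exists (m - 3)./2; lia.
  have [k ->] : exists k, n = (k.*2 + 5).+1 by exists (n - 6)./2; lia.
  by move=> u v uv; apply/separated_two_factor/separated_all.
have [m_ge3|m_lt3] := leqP 3 m.
  split=> //; rewrite ltn_neqAle n_ge4 andbT; apply/eqP=> n4.
  case: m m_odd m_ge3 cyc {m_ge1} => // m m_even m_ge3; rewrite -n4.
  by apply: HTG4_not_cyclable => //; apply: ltnW.
have m1 : m = 1 by lia.
case: n n_ge4 n_even cyc => // n n_ge4 n_odd; rewrite m1 => /HTG1_not_cyclable [].
  by rewrite /= negbK in n_odd.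
exact: ltnW.
Qed.
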